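(* Let $R\subset T$ be a proper extension of integral domains. If each subring of $T$ properly containing $R$ is a valuative domain, then the following hold: (i) $R\subset T$ is an algebraic extension. (ii) $(R,T)$ is a residually algebraic pair. (iii) If $R$ is not a field, then $T$ is an overring of $R$.
   Context: All rings are commutative with identity and are integral domains; $\mathrm{qf}(R)$ denotes the quotient field of $R$. The symbol $\subset$ denotes proper inclusion. An overring of $R$ is a subring of $\mathrm{qf}(R)$ containing $R$. An integral domain $R$ is a valuative domain if for each nonzero $x\in \mathrm{qf}(R)$, at least one of the extensions $R\subseteq R[x]$ and $R\subseteq R[x^{-1}]$ has no ring strictly between its two ends (equality of the two ends is allowed). A ring extension $R\subseteq S$ is residually algebraic if for every prime ideal $Q$ of $S$, $S/Q$ is algebraic over $R/(Q\cap R)$. The pair $(R,T)$ is a residually algebraic pair if $R\subseteq S$ is residually algebraic for every subring $S$ of $T$ containing $R$. *)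

(* Defs.v *)
From HB Require Import structures.
From mathcomp Require Import all_boot all_algebra.
From mathcomp Require Import boolp classical_sets.

Set Implicit Arguments.
Unset Strict Implicit.
Unset Printing Implicit Defensive.

Import GRing.Theory.
Local Open Scope ring_scope.
Local Open Scope quotient_scope.
Local Open Scope classical_set_scope.

(* [subdom S] is the subring [S] of [T] as a type.  The library only turns
   subrings closed under inversion into integral domains ([divringClosed]);
   here the units are those having an inverse in [S] itself, and this predicate
   is made boolean classically. *)
Section SubDomain.
Variables (T : idomainType) (S : subringClosed T).

Definition subdom : Type := {x : T | x \in S}.

HB.instance Definition _ := SubChoice.on subdom.
HB.instance Definition _ := [SubChoice_isSubComNzRing of subdom by <:].

Definition subdom_unit : {pred subdom} := fun x => `[< exists y, y * x = 1 >].

Definition subdom_inv (x : subdom) : subdom :=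
  if pselect (exists y, y * x = 1) is left ex then projT1 (cid ex) else x.

Fact subdom_mulVx : {in subdom_unit, left_inverse 1 subdom_inv *%R}.
Proof.
move=> x /asboolP ex; rewrite /subdom_inv.
by case: pselect => // ex'; case: (cid ex').
Qed.

Fact subdom_unitPl (x y : subdom) : y * x = 1 -> subdom_unit x.
Proof. by move=> yx1; apply/asboolP; exists y. Qed.

Fact subdom_inv_out : {in [predC subdom_unit], subdom_inv =1 id}.
Proof.
move=> x /negP nx; rewrite /subdom_inv.
by case: pselect => // ex; case: nx; apply/asboolP.
Qed.

HB.instance Definition _ := GRing.ComNzRing_hasMulInverse.Build subdom
  subdom_mulVx subdom_unitPl subdom_inv_out.
HB.instance Definition _ := [SubComUnitRing_isSubIntegralDomain of subdom by <:].

End SubDomain.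

Section Inclusion.
Variables (T : idomainType) (R S : subringClosed T) (RS : {subset R <= S}).

Definition incl (x : subdom R) : subdom S := exist _ (val x) (RS (valP x)).

Fact incl_is_zmod_morphism : zmod_morphism incl.
Proof. by move=> x y; apply: val_inj. Qed.

Fact incl_is_monoid_morphism : monoid_morphism incl.
Proof. by split=> [|x y]; apply: val_inj. Qed.

HB.instance Definition _ :=
  GRing.isZmodMorphism.Build (subdom R) (subdom S) incl incl_is_zmod_morphism.
HB.instance Definition _ :=
  GRing.isMonoidMorphism.Build (subdom R) (subdom S) incl
    incl_is_monoid_morphism.

End Inclusion.

Section Valuative.
Variable D : idomainType.

Definition in_fraction : set {fraction D} := range (@tofrac D).

Definition adjoin (x : {fraction D}) : set {fraction D} :=
  range (fun p : {poly D} => (map_poly (@tofrac D) p).[x]).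

Definition no_ring_strictly_between (K : fieldType) (A B : set K) : Prop :=
  ~ exists C : subringClosed K, A `<` [set` C] /\ [set` C] `<` B.

Definition valuative_domain : Prop :=
  forall x : {fraction D}, x != 0 ->
    no_ring_strictly_between in_fraction (adjoin x) \/
    no_ring_strictly_between in_fraction (adjoin x^-1).

End Valuative.

(* The library's [algebraicOver] requires both rings to be fields. *)
Definition algebraic_extension (A B : comNzRingType) (f : {rmorphism A -> B}) :=
  forall b : B, exists2 p : {poly A}, p != 0 & root (map_poly f p) b.

Section Residue.
Variables (A B : comNzRingType) (f : {rmorphism A -> B}) (Q : prime_idealr B).

Definition contraction (a : A) : bool := f a \in Q.

Fact in_contraction a : (a \in contraction) = (f a \in Q).
Proof. by []. Qed.

Fact contraction_idealr_closed : idealr_closed contraction.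
Proof.
split=> [||a u v]; rewrite !in_contraction.
- by rewrite rmorph0 rpred0.
- by rewrite rmorph1 idealr1.
by move=> uQ vQ; rewrite rmorphD rmorphM rpredD // idealMr.
Qed.

Fact contraction_prime : prime_idealr_closed contraction.
Proof. by move=> u v; rewrite !in_contraction rmorphM prime_idealrM. Qed.

HB.instance Definition _ := isIdealr.Build A contraction
  contraction_idealr_closed.
HB.instance Definition _ := isPrimeIdealrClosed.Build A contraction
  contraction_prime.

Definition contraction_ideal : prime_idealr A := contraction.

(* The map A / f^-1(Q) -> B / Q induced by [f]. *)
Definition residue_map (a : {ideal_quot contraction_ideal}) : {ideal_quot Q} :=
  \pi_{ideal_quot Q} (f (repr a)).

Fact residue_mapE (a : A) :
  residue_map (\pi_{ideal_quot contraction_ideal} a) = \pi_{ideal_quot Q} (f a).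
Proof.
apply/eqP; rewrite /residue_map -Quotient.idealrBE -rmorphB.
have : repr (\pi_{ideal_quot contraction_ideal} a) - a \in contraction.
  by rewrite Quotient.idealrBE reprK.
by rewrite in_contraction.
Qed.

Fact residue_map_is_zmod_morphism : zmod_morphism residue_map.
Proof.
by move=> a b; rewrite -[a]reprK -[b]reprK -rmorphB !residue_mapE !rmorphB.
Qed.

Fact residue_map_is_monoid_morphism : monoid_morphism residue_map.
Proof.
split=> [|a b]; first by rewrite -(rmorph1 \pi) residue_mapE !rmorph1.
by rewrite -[a]reprK -[b]reprK -rmorphM !residue_mapE !rmorphM.
Qed.

HB.instance Definition _ := GRing.isZmodMorphism.Build
  {ideal_quot contraction_ideal} {ideal_quot Q} residue_map
  residue_map_is_zmod_morphism.
HB.instance Definition _ := GRing.isMonoidMorphism.Build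
  {ideal_quot contraction_ideal} {ideal_quot Q} residue_map
  residue_map_is_monoid_morphism.

End Residue.

Definition residually_algebraic (A B : comNzRingType) (f : {rmorphism A -> B}) :=
  forall Q : prime_idealr B, algebraic_extension (@residue_map A B f Q).

Definition residually_algebraic_pair (T : idomainType) (R : subringClosed T) :=
  forall (S : subringClosed T) (RS : {subset R <= S}),
    residually_algebraic (incl RS).

(* [B] is identified, over [A], with a subring of the quotient field of [A]. *)
Definition overring (A B : idomainType) (f : {rmorphism A -> B}) :=
  exists2 g : {rmorphism B -> {fraction A}},
    injective g & forall a : A, g (f a) = tofrac a.

(* Main.v *)
(* In a valuative domain D the four pairwise comaximal elements y, y - 1,
   y (y - 1) + 1 and y (y - 1) (y (y - 1) + 1) + 1 cannot all be nonunits. For t in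
   T outside R this applies to D = R[t] and y = t: some q(t), with q monic,
   nonconstant and with integer coefficients, has an inverse g(t) in R[t]. So t is
   a root of q g - 1, which remains nonzero modulo every proper ideal of R; this
   gives (i) and (ii).

   For (iii), if t is not a fraction of elements of R then some multiple of t is
   integral over R with a monic minimal polynomial of degree at least 2; replace t
   by that multiple and let r be a nonzero nonunit of R. In D = R[r^2 t] the
   element t contradicts valuativity: R[r t] lies strictly between D and D[t], and
   D[t] is contained in D[t^-1] because t is integral. *)

Require Import Defs.
From HB Require Import structures.
From mathcomp Require Import all_boot all_algebra.
From mathcomp Require Import boolp classical_sets.
From mathcomp Require Import ring.

Set Implicit Arguments.
Unset Strict Implicit.
Unset Printing Implicit Defensive.

Import GRing.Theory.
Local Open Scope ring_scope.
Local Open Scope classical_set_scope.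

(** * Rings generated by one element *)

Section GeneratedSubring.
Variables (A B : comNzRingType) (f : {rmorphism A -> B}) (x : B).

Definition gen : {pred B} :=
  fun y => `[< exists p : {poly A}, (map_poly f p).[x] = y >].

Lemma genP y : reflect (exists p : {poly A}, (map_poly f p).[x] = y) (y \in gen).
Proof. exact: asboolP. Qed.

Fact gen_subring_closed : subring_closed gen.
Proof.
split=> [|_ _ /genP[p <-] /genP[q <-]|_ _ /genP[p <-] /genP[q <-]]; apply/genP.
- by exists 1; rewrite rmorph1 hornerC.
- by exists (p - q); rewrite rmorphB hornerD hornerN.
by exists (p * q); rewrite rmorphM hornerM.
Qed.

HB.instance Definition _ := GRing.isSubringClosed.Build B gen gen_subring_closed.

Definition gen_ring : subringClosed B := gen.

Lemma gen_base a : f a \in gen.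
Proof. by apply/genP; exists a%:P; rewrite map_polyC hornerC. Qed.

Lemma gen_generator : x \in gen.
Proof. by apply/genP; exists 'X; rewrite map_polyX hornerX. Qed.

Lemma gen_min (C : subringClosed B) :
  (forall a, f a \in C) -> x \in C -> {subset gen <= C}.
Proof.
move=> fC xC _ /genP[p <-]; rewrite horner_coef.
by apply: rpred_sum => i _; rewrite coef_map rpredM //; [exact: fC | exact: rpredX].
Qed.

End GeneratedSubring.

(** The ring in between is D[c]: [c] separates it from [D], and [x] separates it from D[x]. *)
Lemma gen_not_minimal (D : idomainType) (x c : {fraction D}) :
  c \in gen (@tofrac D) x -> ~ in_fraction c -> x \notin gen (@tofrac D) c ->
  ~ no_ring_strictly_between (@in_fraction D) (adjoin x).
Proof.
move=> cx cD xc; apply; exists (gen_ring (@tofrac D) c); split; split.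
- by move=> _ [a _ <-]; exact: gen_base.
- by move=> /(_ c (gen_generator _ _))/cD.
- by move=> y /(gen_min (gen_base _ _) cx)/genP[p <-]; exists p.
move/(_ x); apply: contraNnot xc; apply.
by exists 'X; rewrite // map_polyX hornerX.
Qed.

(** * Comaximal elements in valuative domains *)

Section Fractions.
Variables (D : idomainType) (K : fieldType) (f : {rmorphism D -> K}).

Lemma gen_inv_denominator (b : D) (y : K) : f b != 0 ->
  y \in gen f (f b)^-1 -> exists n d, y * f (b ^+ n) = f d.
Proof.
move=> b0 /genP[p <-]; elim/poly_ind: p => [|p c [n [d e]]].
  by exists 0%N, 0; rewrite map_poly0 horner0 mul0r rmorph0.
exists n.+1, (d + c * b ^+ n.+1).
rewrite (rmorphD (map_poly f)) (rmorphM (map_poly f)) /= map_polyX map_polyC.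
rewrite hornerMXaddC mulrDl.
by rewrite exprS rmorphD !rmorphM /= -e; field.
Qed.

(** Dividing u a + v b = 1 by b gives 1/b = (u c) (a/(b c)) + v. *)
Lemma gen_comaximal_inv (a b c : D) : f b != 0 -> f c != 0 ->
  (exists u v, u * a + v * b = 1) -> (f b)^-1 \in gen f (f a / (f b * f c)).
Proof.
move=> b0 c0 [u [v uv]]; apply/genP; exists ((u * c)%:P * 'X + v%:P).
rewrite rmorphD rmorphM /= map_polyX !map_polyC hornerMXaddC hornerC.
rewrite -[RHS]mul1r -(rmorph1 f) -uv rmorphD !rmorphM /=.
by field; rewrite b0 c0.
Qed.

(** Clearing denominators turns membership into a b^n = d b c, so c divides a power of a b. Since a
    b is invertible modulo c, its factors can be cancelled one by one until c divides 1. *)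
Lemma notin_gen_comaximal_inv (a b c : D) : injective f -> b != 0 -> c != 0 ->
  (exists u v, u * (a * b) + v * c = 1) -> c \isn't a GRing.unit ->
  f a / (f b * f c) \notin gen f (f b)^-1.
Proof.
move=> f_inj b0 c0 [u [v uv]] cU.
have fb0 : f b != 0 by rewrite (raddf_eq0 _ f_inj).
have fc0 : f c != 0 by rewrite (raddf_eq0 _ f_inj).
apply/negP => /(gen_inv_denominator fb0)[n [d e]].
have {}e : a * b ^+ n = d * b * c.
  by apply: f_inj; rewrite !rmorphM /= -e; field; rewrite fb0 fc0.
have key z : (exists w, a * b * z = w * c) -> exists w, z = w * c.
  move=> [w ew]; exists (u * w + v * z).
  by rewrite -[LHS]mul1r -uv !mulrDl -[u * _ * z]mulrA ew; ring.
have [w ew] : exists w, 1 = w * c.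
  have : exists w, (a * b) ^+ n.+1 = w * c.
    exists (d * b * a ^+ n * b).
    have -> : (a * b) ^+ n.+1 = a ^+ n * b * (a * b ^+ n).
      by rewrite exprMn !exprSr; ring.
    by rewrite e; ring.
  by elim: (n.+1) => [|k IH] //; rewrite exprS => /key; exact: IH.
by case/negP: cU; apply/unitrPr; exists w; rewrite mulrC.
Qed.

End Fractions.

Lemma tofrac_inj (D : idomainType) : injective (@tofrac D).
Proof. by move=> a b /eqP; rewrite tofrac_eq => /eqP. Qed.

Section Comaximal.
Variable D : idomainType.
Local Notation "x %:F" := (@tofrac D x).

(** The intermediate ring is D[1/b]: it differs from D because b is not a unit, and from the larger
    ring because c is not a unit. *)
Lemma comaximal_not_minimal (a b c : D) :
  (exists u v, u * a + v * b = 1) -> (exists u v, u * (a * b) + v * c = 1) ->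
  b \isn't a GRing.unit -> c \isn't a GRing.unit ->
  ~ no_ring_strictly_between (@in_fraction D) (adjoin (a%:F / (b%:F * c%:F))).
Proof.
move=> uv uv' bU cU.
have c0 : c != 0.
  apply: contraNneq bU => c0; apply/unitrPr; case: uv' => u [v <-].
  by exists (u * a); rewrite c0; ring.
have b0 : b != 0.
  apply: contraNneq cU => b0; apply/unitrPr; case: uv' => u [v <-].
  by exists v; rewrite b0; ring.
apply: (@gen_not_minimal _ _ (b%:F)^-1).
- by apply: gen_comaximal_inv; rewrite ?tofrac_eq0.
- move=> [d _ /(congr1 ( *%R b%:F))]; rewrite divff ?tofrac_eq0 //.
  rewrite -rmorphM -tofrac1 => /tofrac_inj bd.
  by case/negP: bU; apply/unitrPr; exists d.
exact: notin_gen_comaximal_inv (@tofrac_inj D) _ _ _ _.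
Qed.

(* If none of the four comaximal elements were a unit, the quotient [x] of two
   products of two of them would have rings strictly below both [D[x]] and
   [D[x^-1]]. *)
Lemma valuative_monic_unit (y : D) : valuative_domain D ->
  exists q : {poly int}, [/\ q \is monic, (1 < size q)%N &
    (map_poly intr q).[y] \is a GRing.unit].
Proof.
move=> valD.
have monicD1 (p : {poly int}) : p \is monic -> (1 < size p)%N ->
    (p + 1 \is monic) /\ (1 < size (p + 1)%R)%N.
  move=> pm sp; rewrite monicE lead_coefDl ?size_polyDl ?size_poly1 //.
have [Xm X1m] : ('X : {poly int}) \is monic /\ ('X - 1 : {poly int}) \is monic.
  by rewrite monicX monicXsubC.
pose a3 : {poly int} := 'X * ('X - 1) + 1.
have s2 : size ('X * ('X - 1) : {poly int}) = 3.
  by rewrite size_Mmonic ?monic_neq0 // size_polyX size_XsubC.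
have [a3m sa3] : a3 \is monic /\ (1 < size a3)%N.
  by apply: monicD1; rewrite ?s2 // monicMr.
pose a4 : {poly int} := 'X * ('X - 1) * a3 + 1.
have [a4m sa4] : a4 \is monic /\ (1 < size a4)%N.
  apply: monicD1; first by rewrite monicMl ?monicMr.
  by rewrite size_Mmonic ?s2 ?monic_neq0 ?monicMr //; case: (size _) sa3.
apply: contrapT => nounit.
have nonunit (q : {poly int}) : q \is monic -> (1 < size q)%N ->
    (map_poly intr q).[y] \isn't a GRing.unit.
  by move=> qm sq; apply/negP => qU; apply: nounit; exists q.
have nX := nonunit _ Xm; have nX1 := nonunit _ X1m.
have n3 := nonunit _ a3m sa3; have n4 := nonunit _ a4m sa4.
rewrite size_polyX size_XsubC in nX nX1.
have {}nX := nX isT; have {}nX1 := nX1 isT.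
have e1 : (map_poly intr ('X : {poly int})).[y] = y by rewrite map_polyX hornerX.
have e2 : (map_poly intr ('X - 1 : {poly int})).[y] = y - 1.
  by rewrite rmorphB rmorph1 /= map_polyX hornerD hornerX hornerN hornerC.
have e3 : (map_poly intr a3).[y] = y * (y - 1) + 1.
  by rewrite rmorphD rmorphM rmorph1 /= hornerD hornerM e1 e2 hornerC.
have e4 : (map_poly intr a4).[y] = y * (y - 1) * (y * (y - 1) + 1) + 1.
  by rewrite rmorphD !rmorphM rmorph1 /= hornerD !hornerM e1 e2 e3 hornerC.
rewrite {}e1 in nX; rewrite {}e2 in nX1; rewrite {}e3 in n3; rewrite {}e4 in n4.
set z := y - 1 in nX1 n3 n4; have yz : y = z + 1 by rewrite subrK.
set b3 := y * z + 1 in n3 n4; set b4 := y * z * b3 + 1 in n4.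
have unit_of (a b : D) : a * b = 1 -> a \is a GRing.unit.
  by move=> ab; apply/unitrPr; exists b.
(* If one of the four elements vanished, another would be a unit. *)
have y0 : y != 0.
  by apply: contraNneq nX1 => y0; apply: (unit_of _ (- 1)); rewrite /z y0; ring.
have z0 : z != 0.
  by apply: contraNneq nX => z0; apply: (unit_of _ 1); rewrite yz z0; ring.
have b30 : b3 != 0.
  by apply: contraNneq n4 => b30; apply: (unit_of _ 1); rewrite /b4 b30; ring.
have b40 : b4 != 0.
  apply: contraNneq nX => b40; apply: (unit_of _ (- z * b3)).
  by transitivity (1 - b4); [rewrite /b4; ring | rewrite b40 subr0].
have [||] := valD ((y * z)%:F / (b3%:F * b4%:F)).
- by rewrite mulf_neq0 ?invr_eq0 ?mulf_neq0 ?tofrac_eq0 ?mulf_neq0.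
- apply: comaximal_not_minimal => //; exists (- 1), 1; rewrite /b4 /b3; ring.
have -> : ((y * z)%:F / (b3%:F * b4%:F))^-1 = (b3 * b4)%:F / (y%:F * z%:F).
  by rewrite invf_div; congr (_ / _); rewrite tofracM.
apply: comaximal_not_minimal => //.
(* With w = y z, the product b3 b4 is 1 + w (w^2 + 2 w + 2). Both identities follow from this, the
   second one using also y = z + 1. *)
- exists 1, (- z * ((y * z) ^+ 2 + (y * z) *+ 2 + 2)); rewrite /b4 /b3; ring.
exists 1, (- (1 + y * y * ((y * z) ^+ 2 + (y * z) *+ 2 + 2))).
rewrite /b4 /b3 yz; ring.
Qed.

End Comaximal.

(** * Roots of polynomials with unit content *)

Lemma rmorph_horner_intr (A B : comNzRingType) (f : {rmorphism A -> B})
    (q : {poly int}) (a : A) :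
  f (map_poly intr q).[a] = (map_poly intr q).[f a].
Proof.
rewrite -horner_map -map_poly_comp; congr _.[_].
by apply: eq_map_poly => i /=; rewrite rmorph_int.
Qed.

(* The condition on all [h] says that the coefficients of [p] generate the unit
   ideal of [A]. *)
Definition primitive_root (A B : comNzRingType) (f : {rmorphism A -> B}) (t : B) :=
  exists2 p : {poly A}, root (map_poly f p) t &
    forall (C : comNzRingType) (h : {rmorphism A -> C}), map_poly h p != 0.

Lemma primitive_root_image (A B : comNzRingType) (f : {rmorphism A -> B}) (a : A) :
  primitive_root f (f a).
Proof.
exists ('X - a%:P); first by rewrite map_polyXsubC root_XsubC.
by move=> C h; rewrite map_polyXsubC polyXsubC_eq0.
Qed.

(** The witness is q g - 1: over any nonzero ring q stays monic and nonconstant, so the image of q g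
    is either 0 or nonconstant, hence never 1. *)
Lemma primitive_root_monic_unit (A B : comNzRingType) (f : {rmorphism A -> B})
    (t z : B) (q : {poly int}) :
  q \is monic -> (1 < size q)%N -> z \in gen f t ->
  (map_poly intr q).[t] * z = 1 -> primitive_root f t.
Proof.
move=> qm sq /genP[g <-] qg1; exists (map_poly intr q * g - 1).
  rewrite rootE rmorphB rmorphM rmorph1 /= hornerD hornerN hornerM hornerC.
  rewrite -map_poly_comp -qg1 subr_eq0; apply/eqP; congr (_.[_] * _).
  by apply: eq_map_poly => i /=; rewrite rmorph_int.
move=> C h; rewrite rmorphB rmorphM rmorph1 subr_eq0 /=.
pose hi : {rmorphism int -> C} := h \o intr.
have qhm : map_poly hi q \is monic by exact: monic_map.
have sqh : size (map_poly hi q) = size q.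
  by rewrite size_map_poly_id0 // (monicP qm) rmorph1 oner_neq0.
have -> : map_poly h (map_poly intr q) = map_poly hi q by rewrite -map_poly_comp.
have [->|g0] := eqVneq (map_poly h g) 0; first by rewrite mulr0 eq_sym oner_neq0.
apply/eqP => /(congr1 (size \o polyseq)) /=.
rewrite size_monicM // sqh size_poly1; move: g0; rewrite -size_poly_eq0.
by case: (size q) (size (map_poly h g)) sq => [|[|m]] [|k] // _ _; rewrite addnS.
Qed.

Lemma primitive_root_inj (A B C : comNzRingType) (f : {rmorphism A -> B})
    (g : {rmorphism B -> C}) (h : {rmorphism A -> C}) (b : B) :
  injective g -> (forall a, g (f a) = h a) -> primitive_root h (g b) ->
  primitive_root f b.
Proof.
move=> g_inj gf [p /rootP pb p_prim]; exists p => //; apply/rootP/g_inj.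
rewrite rmorph0 -pb -horner_map -map_poly_comp; congr _.[_].
exact: eq_map_poly.
Qed.

Lemma primitive_root_algebraic (A B : comNzRingType) (f : {rmorphism A -> B})
    (b : B) :
  primitive_root f b -> exists2 p : {poly A}, p != 0 & root (map_poly f p) b.
Proof. by move=> [p pb /(_ _ idfun)]; rewrite map_poly_id //; exists p. Qed.

(** The nonvanishing condition survives reduction of the coefficients, because any further map [h]
    composed with the projection is again a map out of [A]. *)
Lemma primitive_root_residue (A B : comNzRingType) (f : {rmorphism A -> B})
    (Q : prime_idealr B) (b : B) :
  primitive_root f b -> primitive_root (@residue_map A B f Q) (\pi_{ideal_quot Q}%qT b).
Proof.
move=> [p /rootP pb p_prim]; set I := contraction_ideal f Q.
pose piA : {rmorphism A -> {ideal_quot I}} := \pi_{ideal_quot I}%qT.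
pose piB : {rmorphism B -> {ideal_quot Q}} := \pi_{ideal_quot Q}%qT.
exists (map_poly piA p); last first.
  by move=> C h; rewrite -map_poly_comp; exact: (p_prim _ (h \o piA)).
apply/rootP; rewrite -[RHS](rmorph0 piB) -pb -horner_map -!map_poly_comp.
by congr _.[_]; apply: eq_map_poly => a; exact: residue_mapE.
Qed.

(** * Algebraicity and residual algebraicity *)

Section SubringGeneration.
Variables (T : idomainType) (R : subringClosed T).
Local Notation "'val_R'" := (val : {rmorphism subdom R -> T}).

Lemma sub_gen (t : T) : {subset R <= gen val_R t}.
Proof. by move=> a aR; rewrite -[a](SubK (subdom R) aR) gen_base. Qed.

Hypothesis valuative_subrings : forall S : subringClosed T,
  [set` R] `<` [set` S] -> valuative_domain (subdom S).

Lemma gen_valuative (t : T) : t \notin R -> valuative_domain (subdom (gen_ring val_R t)).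
Proof.
move=> tR; apply: valuative_subrings; split; first exact: sub_gen.
by move/(_ t (gen_generator _ _)); apply/negP.
Qed.

Lemma primitive_root_valuative (t : T) : primitive_root val_R t.
Proof.
have [tR|tR] := boolP (t \in R).
  exact: (primitive_root_image val_R (Sub t tR)).
pose y : subdom (gen_ring val_R t) := Sub t (gen_generator _ _).
have [q [qm sq]] := valuative_monic_unit y (gen_valuative tR).
move=> /unitrPr[z /(congr1 (val : {rmorphism subdom (gen_ring val_R t) -> T}))].
rewrite rmorphM rmorph1 rmorph_horner_intr.
exact: primitive_root_monic_unit qm sq (valP z).
Qed.

Lemma algebraic_of_valuative_subrings : algebraic_extension val_R.
Proof. by move=> t; exact/primitive_root_algebraic/primitive_root_valuative. Qed.

(** A representative of the residue class, seen in [T], is a root of a polynomial over [R] with unit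
    content. The same polynomial works in [S] and stays nonzero modulo [Q]. *)
Lemma residually_algebraic_of_valuative_subrings : residually_algebraic_pair R.
Proof.
move=> S RS Q b; apply: primitive_root_algebraic.
rewrite -[b]reprK; apply: primitive_root_residue.
apply: (@primitive_root_inj _ _ _ _ val val_R) => //; first exact: val_inj.
exact: primitive_root_valuative.
Qed.

End SubringGeneration.

(** * Denominators, integral multiples and minimal polynomials *)

Lemma overring_of_denominators (A B : idomainType) (f : {rmorphism A -> B}) :
  injective f -> (forall b, exists a c, a != 0 /\ f a * b = f c) -> overring f.
Proof.
move=> f_inj den.
have /choice[h hP] (b : B) : exists ac : A * A, ac.1 != 0 /\ f ac.1 * b = f ac.2.
  by have [a [c ac]] := den b; exists (a, c).
pose g (b : B) : {fraction A} := tofrac (h b).2 / tofrac (h b).1.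
(* The value of [g] does not depend on the chosen fraction, so sums and products may be computed
   with any convenient denominator. *)
have gE a b c : a != 0 -> f a * b = f c -> g b = tofrac c / tofrac a.
  have [h0 hb] := hP b; move=> a0 ab; apply/eqP.
  rewrite /g eqr_div ?tofrac_eq0 // -!tofracM tofrac_eq; apply/eqP/f_inj.
  by rewrite !rmorphM -ab -hb; ring.
have g_zmod : zmod_morphism g.
  move=> x y; have [x0 hx] := hP x; have [y0 hy] := hP y.
  rewrite (gE ((h x).1 * (h y).1) _ ((h x).2 * (h y).1 - (h y).2 * (h x).1)).
  - by rewrite tofracB !tofracM /g -[in RHS]mulNr addf_div ?tofrac_eq0 // mulNr.
  - by rewrite mulf_neq0.
  by rewrite rmorphB !rmorphM -hx -hy; ring.
have g_monoid : monoid_morphism g.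
  split=> [|x y]; first by rewrite (gE 1 _ 1) ?oner_neq0 ?mulr1 // divr1 tofrac1.
  have [x0 hx] := hP x; have [y0 hy] := hP y.
  rewrite (gE ((h x).1 * (h y).1) _ ((h x).2 * (h y).2)).
  - by rewrite !tofracM /g mulf_div.
  - by rewrite mulf_neq0.
  by rewrite !rmorphM -hx -hy; ring.
pose gA := GRing.isZmodMorphism.Build _ _ g g_zmod.
pose gM := GRing.isMonoidMorphism.Build _ _ g g_monoid.
pose G : {rmorphism B -> {fraction A}} := HB.pack g gA gM.
exists G => [|a]; last first.
  by rewrite [LHS](gE 1 _ a) ?oner_neq0 ?rmorph1 ?mul1r // divr1.
apply: raddf_inj => b gb0; have [b0 hb] := hP b; apply/eqP; move/eqP: gb0.
rewrite -[_ b]/(g b) mulf_eq0 invr_eq0 !tofrac_eq0 (negPf b0) orbF => /eqP c0.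
by move/eqP: hb; rewrite c0 rmorph0 mulf_eq0 (raddf_eq0 _ f_inj) (negPf b0).
Qed.

(** For [m] of degree k + 1, solve m(x) = 0 for x^(k+1) and divide by x^k: this writes x as a
    polynomial in 1/x. *)
Lemma gen_integral_inv (A : comNzRingType) (K : fieldType) (f : {rmorphism A -> K})
    (m : {poly A}) (x : K) :
  x != 0 -> m \is monic -> root (map_poly f m) x -> x \in gen f x^-1.
Proof.
move=> x0 m_monic /rootP; rewrite (@horner_coef_wide _ (size m)) ?size_poly //.
have := monicP m_monic; have := monic_neq0 m_monic.
rewrite -size_poly_eq0 /lead_coef; case: (size m) => [//|[|k]] _ m1.
  by rewrite big_ord1 coef_map m1 /= rmorph1 mulr1 => /eqP; rewrite oner_eq0.
rewrite big_ord_recr /= coef_map m1 /= rmorph1 mul1r => /eqP.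
rewrite addrC addr_eq0 => /eqP xk.
have xE : x = x ^+ k.+1 * x^-1 ^+ k.
  by rewrite exprS -mulrA -exprMn divff // expr1n mulr1.
rewrite [X in X \in _]xE xk mulNr rpredN mulr_suml; apply: rpred_sum => i _.
rewrite coef_map -mulrA; apply: rpredM; first exact: gen_base.
have -> : x ^+ i * x^-1 ^+ k = x^-1 ^+ (k - i).
  have ik : (i <= k)%N := ltn_ord i.
  rewrite -[in X in _ * X](subnK ik) exprD mulrCA -exprMn divff //.
  by rewrite expr1n mulr1.
by apply/genP; exists 'X^(k - i); rewrite map_polyXn hornerXn.
Qed.

Definition integral_minpoly (A B : comNzRingType) (f : {rmorphism A -> B})
    (t : B) (m : {poly A}) :=
  [/\ m \is monic, root (map_poly f m) t &
    forall q : {poly A}, (size q < size m)%N -> root (map_poly f q) t -> q = 0].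

(** Let [p] have least degree d among the nonzero polynomials vanishing at [t], and let [c] be its
    leading coefficient. Multiplying p(t) = 0 by c^(d-1) gives a monic equation of degree d for c
    t. *)
Lemma exists_integral_multiple (A B : idomainType) (f : {rmorphism A -> B}) (t : B) :
  injective f -> (exists2 p : {poly A}, p != 0 & root (map_poly f p) t) ->
  exists c m, c != 0 /\ integral_minpoly f (f c * t) m.
Proof.
move=> f_inj [p0 p00 p0t].
pose P n := `[< exists p : {poly A}, [/\ p != 0, root (map_poly f p) t & size p = n] >].
have exP : exists n, P n by exists (size p0); apply/asboolP; exists p0.
case: (ex_minnP exP) => n /asboolP[p [p_neq0 /rootP pt sp]] n_min.
have {n_min} p_min (q : {poly A}) : (size q < size p)%N -> root (map_poly f q) t -> q = 0.
  move=> sq qt; apply/eqP; apply: contraTT sq => q0; rewrite -leqNgt sp.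
  by apply: n_min; apply/asboolP; exists q.
set c := lead_coef p; have c0 : c != 0 by rewrite lead_coef_eq0.
set d := (size p).-1.
have spd : size p = d.+1 by rewrite prednK // size_poly_gt0.
pose m : {poly A} := 'X^d + \poly_(i < d) (p`_i * c ^+ (d.-1 - i)).
have sm : size m = d.+1.
  by rewrite size_polyDl ?size_polyXn // ltnS size_poly.
exists c, m; split=> //; split.
- by rewrite monicE lead_coefDl ?lead_coefXn // size_polyXn ltnS size_poly.
(* In degree 0, [p] would be the constant [c] and f c = 0. Hence [d.-1] is a true predecessor. *)
- have d_gt0 : (0 < d)%N.
    rewrite lt0n; apply: contraNneq c0 => d0; rewrite -(raddf_eq0 _ f_inj) /=.
    have /size1_polyC p_const : (size p <= 1)%N by rewrite spd d0.
    by rewrite /c p_const lead_coefC -pt {2}p_const map_polyC hornerC.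
  apply/rootP; rewrite (@horner_coef_wide _ d.+1); last first.
    by rewrite -sm size_poly.
  rewrite big_ord_recr /=.
  transitivity (f c ^+ d.-1 * (map_poly f p).[t]); last by rewrite pt mulr0.
  rewrite (@horner_coef_wide _ d.+1 (map_poly f p)); last by rewrite -spd size_poly.
  rewrite big_ord_recr /= mulrDr mulr_sumr; congr (_ + _).
    apply: eq_bigr => i _; rewrite !coef_map coefD coefXn coef_poly ltn_ord.
    rewrite (ltn_eqF (ltn_ord i)) add0r /= rmorphM rmorphXn exprMn.
    have id : (i <= d.-1)%N by rewrite -ltnS prednK.
    by rewrite -{2}(subnK id) exprD; ring.
  rewrite !coef_map coefD coefXn eqxx coef_poly ltnn addr0 /= rmorph1 mul1r exprMn.
  by rewrite -[p`_d]/c mulrA -exprSr prednK.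
(* Substituting c X for X preserves the size of [q] and yields a polynomial vanishing at [t], so the
   minimality of [p] applies. *)
move=> q sq /rootP qt; have sX : size (c *: 'X : {poly A}) = 2.
  by rewrite size_scale // size_polyX.
apply/eqP; rewrite -size_poly_eq0 -(size_comp_poly2 q sX) size_poly_eq0.
apply/eqP/p_min; first by rewrite size_comp_poly2 // spd -sm.
apply/rootP; rewrite map_comp_poly horner_comp map_polyZ map_polyX hornerZ hornerX.
exact: qt.
Qed.

(* With [g] the polynomial witnessing the membership, reducing
   [u X - g (u r X)] modulo [m] gives a polynomial of smaller degree vanishing at
   [t]; its coefficient of [X] is [u] minus a multiple of [u r]. *)
Lemma unit_of_multiple_in_gen (A B : idomainType) (f : {rmorphism A -> B})
    (t : B) (m : {poly A}) (r u : A) :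
  integral_minpoly f t m -> (2 < size m)%N -> u != 0 ->
  f u * t \in gen f (f (u * r) * t) -> exists w, r * w = 1.
Proof.
move=> [m_monic /rootP mt m_min] sm u0 /genP[g gt].
(* Apart from its constant term, a polynomial in u r t is u r times a polynomial in t. *)
have [h [c hE]] : exists h c, f u * t = f (u * r) * (map_poly f h).[t] + f c.
  elim/poly_ind: g gt => [|g c _] <-.
    by exists 0, 0; rewrite !map_poly0 !horner0 mulr0 rmorph0 addr0.
  exists ((g \Po ((u * r) *: 'X)) * 'X), c.
  rewrite !rmorphD !rmorphM /= map_polyX map_polyC hornerMXaddC.
  rewrite map_comp_poly hornerMX horner_comp map_polyZ map_polyX hornerZ hornerX.
  by rewrite !rmorphM; ring.
set h' := Pdiv.Ring.rmodp h m.
have sh' : (size h' < size m)%N.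
  by rewrite Pdiv.Ring.ltn_rmodp monic_neq0.
have h't : (map_poly f h).[t] = (map_poly f h').[t].
  rewrite {1}(Pdiv.RingMonic.rdivp_eq m_monic h) rmorphD rmorphM /= hornerD hornerM.
  by rewrite mt mulr0 add0r.
(* The degree of [m] is at least 2, so the term u X is already reduced modulo [m]. *)
have /m_min q0 : (size (u *: 'X - (u * r) *: h' - c%:P)%R < size m)%N.
  rewrite (leq_ltn_trans (size_polyD _ _)) // gtn_max size_polyN.
  rewrite (leq_ltn_trans (size_polyC_leq1 _)) ?andbT; last by case: (size m) sm => [|[]].
  rewrite (leq_ltn_trans (size_polyD _ _)) // gtn_max size_polyN.
  rewrite !(leq_ltn_trans (size_scale_leq _ _)) //.
  by rewrite size_polyX.
have {}q0 : u *: 'X - (u * r) *: h' - c%:P = 0.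
  apply/q0/rootP; rewrite !rmorphB /= !map_polyZ map_polyX map_polyC.
  by rewrite !hornerD !hornerN !hornerZ hornerX hornerC hE h't; ring.
exists h'`_1; apply: (mulfI u0); rewrite mulrA mulr1.
move/(congr1 (fun q : {poly A} => q`_1)): q0.
rewrite !coefB !coefZ coefX coefC coef0 mulr1 subr0 => /eqP.
by rewrite subr_eq0 => /eqP.
Qed.

Lemma gen_rmorph (A B C : comNzRingType) (f : {rmorphism A -> B})
    (g : {rmorphism B -> C}) (h : {rmorphism A -> C}) (x b : B) :
  injective g -> (forall a, g (f a) = h a) ->
  (g b \in gen h (g x)) = (b \in gen f x).
Proof.
move=> g_inj gf.
have gp p : g (map_poly f p).[x] = (map_poly h p).[g x].
  by rewrite -horner_map -map_poly_comp; congr _.[_]; exact: eq_map_poly.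
by apply/genP/genP => -[p pE]; exists p; [apply: g_inj; rewrite gp | rewrite -gp pE].
Qed.

(** A power of [k] turns a polynomial in t into one in k t; each Horner step costs one more factor
    [k]. *)
Lemma gen_denominator (A B : idomainType) (f : {rmorphism A -> B}) (t w : B) (k : A) :
  k != 0 -> w \in gen f t ->
  exists a, a != 0 /\ f a * w \in gen f (f k * t).
Proof.
move=> k0 /genP[p <-]; elim/poly_ind: p => [|p c [a [a0 ap]]].
  by exists 1; rewrite oner_neq0 map_poly0 horner0 mulr0 rpred0.
exists (a * k); split; first exact: mulf_neq0.
rewrite (rmorphD (map_poly f)) (rmorphM (map_poly f)) /= map_polyX map_polyC.
rewrite hornerMXaddC rmorphM mulrDr.
rewrite mulrACA -!rmorphM rpredD //; last exact: gen_base.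
by rewrite rpredM ?gen_generator.
Qed.

(** * The tower A[r^2 t], A[r t], A[t] over an integral element t *)

Section IntegralTower.
Variables (A D W : idomainType) (f : {rmorphism A -> W}).
Variables (i : {rmorphism A -> D}) (j : {rmorphism D -> W}).
Hypotheses (j_inj : injective j) (ji : forall a, j (i a) = f a).
Hypothesis f_inj : injective f.
Variables (t0 : W) (c : A) (m : {poly A}) (r : A) (s : D).
Local Notation t := (f c * t0).
Hypotheses (c0 : c != 0) (m_min : integral_minpoly f t m) (sm : (2 < size m)%N).
Hypotheses (r0 : r != 0) (rU : r \isn't a GRing.unit).
Hypothesis W_gen : forall w, w \in gen f t0.
Hypotheses (D_gen : forall d, d \in gen i s) (sE : j s = f (r * r) * t).

Lemma integral_tower_not_valuative : ~ valuative_domain D.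
Proof.
have jD d : j d \in gen f (f (r * r) * t) by rewrite -sE (gen_rmorph _ _ j_inj ji).
(* For u = r this keeps r t out of [D]; for u = 1 it keeps t out of A[r t]. *)
have nonunit u : u != 0 -> f u * t \notin gen f (f (u * r) * t).
  move=> u0; apply: contraNN rU => /(unit_of_multiple_in_gen m_min sm u0)[w rw].
  by apply/unitrPr; exists w.
(* With k = r r c, every element of [W] has a nonzero multiple in the image of [D], so [W] embeds in
   the quotient field of [D]. *)
have [] : overring j.
  apply: overring_of_denominators => // w.
  have k0 : r * r * c != 0 by rewrite !mulf_neq0.
  have [a [a0]] := gen_denominator k0 (W_gen w).
  rewrite rmorphM -mulrA -sE => /genP[p pE]; exists (i a), (map_poly i p).[s].
  split.
    by apply: contraNneq a0 => ia0; apply/eqP/f_inj; rewrite -ji ia0 !rmorph0.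
  rewrite ji -pE -horner_map -map_poly_comp; congr _.[_].
  by apply: eq_map_poly => b; rewrite /= ji.
move=> G G_inj Gj valD.
have t_neq0 : t != 0.
  apply: contraTneq isT => t0E; have [_ _ /(_ 'X)] := m_min.
  rewrite size_polyX map_polyX t0E rootE hornerX eqxx => /(_ sm isT).
  by move/eqP; rewrite polyX_eq0.
pose x := G t; have x0 : x != 0 by rewrite (raddf_eq0 _ G_inj).
pose y := G (f r * t).
have yE : y = tofrac (i r) * x by rewrite /y rmorphM -ji Gj.
have yx : y \in gen (@tofrac D) x.
  by rewrite yE rpredM ?gen_base ?gen_generator.
have yD : ~ in_fraction y.
  move=> [d _]; rewrite -Gj => /G_inj dE.
  by move: (nonunit _ r0); rewrite -dE jD.
(* Since r^2 t = r (r t), the image of [D] lies in A[r t], so membership of x in D[y] would put t in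
   A[r t]. *)
have xy : x \notin gen (@tofrac D) y.
  rewrite (gen_rmorph _ _ G_inj Gj); apply: contraNN (nonunit 1 (oner_neq0 _)) => tj.
  rewrite rmorph1 !mul1r.
  apply: (gen_min (C := gen_ring f (f r * t))) tj; last exact: gen_generator.
  move=> d; apply: (gen_min (C := gen_ring f (f r * t))) (jD d).
    exact: gen_base.
  by rewrite rmorphM -mulrA rpredM ?gen_base ?gen_generator.
have x_inv : x \in gen (@tofrac D) x^-1.
  have [m_monic /rootP mt _] := m_min.
  apply: (@gen_integral_inv _ _ _ (map_poly i m)) => //; first exact: monic_map.
  apply/rootP; rewrite -[RHS](rmorph0 G) -mt -horner_map -!map_poly_comp.
  by congr _.[_]; apply: eq_map_poly => a; rewrite /= -ji Gj.
have [] := valD x x0.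
  exact: gen_not_minimal yx yD xy.
(* The same ring D[y] serves for 1/x: y lies in D[x], hence in D[1/x], and if 1/x were in D[y] then
   so would be x. *)
apply: gen_not_minimal yD _.
  by apply: (gen_min (C := gen_ring _ _)) yx; [exact: gen_base | exact: x_inv].
apply: contraNN xy => xVy.
by apply: (gen_min (C := gen_ring _ _)) x_inv; [exact: gen_base | exact: xVy].
Qed.

End IntegralTower.

(** * The overring statement *)

Lemma integral_minpoly_linear (A B : comNzRingType) (f : {rmorphism A -> B})
    (t : B) (m : {poly A}) :
  integral_minpoly f t m -> (size m <= 2)%N -> exists a, t = f a.
Proof.
move=> [/monicP m_monic /rootP mt _] sm.
move: mt; rewrite (@horner_coef_wide _ 2) ?(leq_trans (size_poly _ _)) //.
rewrite 2!big_ord_recl big_ord0 addr0 !coef_map /= mulr1 => mt.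
move: m_monic mt sm; rewrite /lead_coef.
(* For size 0 or 1 the constant coefficient is 1 and the equation [mt] reads 1 = 0. *)
case: (size m) (@nth_default _ 0 m 1) => [|[|[|k]]] // m1 m0 mt _.
- by move: mt; rewrite m1 // m0 !rmorph1 rmorph0 mul0r addr0 => /eqP; rewrite oner_eq0.
- by move: mt; rewrite m1 // m0 !rmorph1 rmorph0 mul0r addr0 => /eqP; rewrite oner_eq0.
exists (- m`_0); apply/eqP; rewrite rmorphN -addr_eq0 addrC.
by rewrite -mt m0 rmorph1 mul1r.
Qed.

Lemma incl_inj (T : idomainType) (R S : subringClosed T) (RS : {subset R <= S}) :
  injective (incl RS).
Proof. by move=> a b /(congr1 val) /= /val_inj. Qed.

Lemma overring_of_valuative_subrings (T : idomainType) (R : subringClosed T) :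
  (forall S : subringClosed T, [set` R] `<` [set` S] -> valuative_domain (subdom S)) ->
  ~ GRing.field_axiom (subdom R) -> overring (val : {rmorphism subdom R -> T}).
Proof.
move=> valuative_subrings /existsNP[r /not_implyP[r0 rU]].
set val_R := (val : {rmorphism subdom R -> T}).
apply: overring_of_denominators; first exact: val_inj.
move=> t0; apply: contrapT => no_den.
(* Working in R[t0] instead of [T] makes powers of a single element sufficient as denominators. *)
pose W := gen_ring val_R t0.
pose f : {rmorphism subdom R -> subdom W} := incl (@sub_gen _ R t0).
have f_inj : injective f by exact: incl_inj.
have val_f a : val (f a) = val_R a by [].
pose t0W : subdom W := Sub t0 (gen_generator _ _).
have alg : exists2 p : {poly subdom R}, p != 0 & root (map_poly f p) t0W.
  apply: primitive_root_algebraic.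
  apply: (@primitive_root_inj _ _ _ f val val_R) => //; first exact: val_inj.
  exact: primitive_root_valuative.
have [c [m [c0 m_min]]] := exists_integral_multiple f_inj alg.
have no_den_f a b : a != 0 -> f a * t0W <> f b.
  move=> a0 /(congr1 val) ab; apply: no_den; exists a, b; split=> //; exact: ab.
(* Otherwise c t0 would lie in [R] and t0 would be a fraction. *)
have sm : (2 < size m)%N.
  rewrite ltnNge; apply/negP => /(integral_minpoly_linear m_min)[b].
  exact: no_den_f.
set y := f (r * r) * (f c * t0W).
pose S := gen_ring val_R (val y).
have SW : {subset S <= W}.
  by apply: (gen_min (C := W)); [exact: gen_base | exact: (valP y)].
have yS : val y \in S by exact: gen_generator.
(* If it were in [R], then r r c would be a denominator of t0. Hence R[y] properly contains [R] and
   is valuative. *)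
have yR : val y \notin R.
  apply/negP => yR; apply: (@no_den_f (r * r * c) (Sub (val y) yR)).
    by rewrite !mulf_neq0.
  by rewrite rmorphM -mulrA; exact: val_inj.
pose i : {rmorphism subdom R -> subdom S} := incl (@sub_gen _ R (val y)).
apply: (integral_tower_not_valuative (i := i) (j := incl SW) (s := Sub (val y) yS)
  _ _ f_inj c0 m_min sm r0).
- exact: incl_inj.
- by move=> a; exact: val_inj.
- exact/negP.
- move=> w; rewrite -(gen_rmorph _ _ val_inj val_f); exact: (valP w).
- move=> d; rewrite -(@gen_rmorph _ _ _ i val val_R _ _ val_inj) //; exact: (valP d).
- exact: val_inj.
exact: gen_valuative.
Qed.

Theorem theorem2p1 (T : idomainType) (R : subringClosed T)
    (properRT : [set` R] `<` [set: T])
    (valuative_subrings : forall S : subringClosed T,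
      [set` R] `<` [set` S] -> valuative_domain (subdom S)) :
  [/\ algebraic_extension (val : {rmorphism subdom R -> T}),
      residually_algebraic_pair R
    & ~ GRing.field_axiom (subdom R) ->
      overring (val : {rmorphism subdom R -> T})].
Proof.
split; first exact: algebraic_of_valuative_subrings.
  exact: residually_algebraic_of_valuative_subrings.
exact: overring_of_valuative_subrings.
Qed.
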